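(* Let $\lambda_i>0$ be an eigenvalue of $-\Delta_{W,V}$ with eigenvector $\nu_i$, i.e. $\nu_i\in\mathcal{D}_{W,V}(\mathbb{T})\setminus\{0\}$ and $-\Delta_{W,V}\nu_i=\lambda_i\nu_i$. Then there exist $a_i,b_i\in\mathbb{R}$ such that $$\nu_{i}(x)=a_{i}C_{W,V}\left(\sqrt{\lambda_{i}},x\right)+\frac{b_{i}}{\sqrt{\lambda_{i}}}S_{W,V}\left(\sqrt{\lambda_{i}},x\right)\qquad V\text{-a.e.}$$ Furthermore, the vector $(a_i,b_i)\neq(0,0)$ is obtained as a solution of the system $$\begin{cases} a_{i}\left[C_{W,V}(\sqrt{\lambda_{i}},1)-1\right]+\dfrac{b_{i}}{\sqrt{\lambda_{i}}}S_{W,V}(\sqrt{\lambda_{i}},1)=0,\\[2mm] \dfrac{a_{i}}{\sqrt{\lambda_{i}}}S_{V,W}(\sqrt{\lambda_{i}},1)-\dfrac{b_{i}}{\lambda_{i}}\left[C_{V,W}(\sqrt{\lambda_{i}},1)-1\right]=0.\end{cases}$$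
   Context: Setting. $\mathbb{T}=\mathbb{R}/\mathbb{Z}$, identified with $[0,1)$ with tagged point $0$. $W,V:\mathbb{R}\to\mathbb{R}$ are strictly increasing, $W$ càdlàg (right-continuous with left limits), $V$ càglàd (left-continuous with right limits), with $W(x+1)-W(x)=W(1)-W(0)$ and $V(x+1)-V(x)=V(1)-V(0)$ for all $x$; both are continuous at $0$ and $W(0)=V(0)=0$. They induce finite Borel measures with $dW((a,b])=W(b)-W(a)$, $dV([a,b))=V(b)-V(a)$ (atoms allowed). $L^2_V(\mathbb{T})=L^2(\mathbb{T},dV)$, and $L^2_{V,0}(\mathbb{T})$ is its mean-zero subspace. Laplacian: the domain $\mathcal{D}_{W,V}(\mathbb{T})$ is the set of $f\in L^2_V(\mathbb{T})$ with $f(x)=a+bW(x)+\int_{(0,x]}\int_{[0,y)}\mathfrak{f}(s)\,dV(s)\,dW(y)$ $V$-a.e. for some $a,b\in\mathbb{R}$, $\mathfrak{f}\in L^2_{V,0}(\mathbb{T})$ with $bW(1)+\int_{(0,1]}\int_{[0,y)}\mathfrak{f}\,dV\,dW(y)=0$; then $\Delta_{W,V}f=\mathfrak{f}$. Generalized polynomials, for $x,s\in[0,1]$: $F_1(x,s)=W(s)$, $G_1(x,s)=V(s)$, and for $n\ge2$ $F_n(x,s)=\int_{[0,s)}[F_{n-1}(x,x)-F_{n-1}(x,\xi)]\,dV(\xi)$ for $n$ even, $F_n(x,s)=\int_{(0,s]}[F_{n-1}(x,x)-F_{n-1}(x,\xi)]\,dW(\xi)$ for $n$ odd; $G_n(x,s)=\int_{(0,s]}[G_{n-1}(x,x)-G_{n-1}(x,\xi)]\,dW(\xi)$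 for $n$ even, $G_n(x,s)=\int_{[0,s)}[G_{n-1}(x,x)-G_{n-1}(x,\xi)]\,dV(\xi)$ for $n$ odd; also $F_0(x,x)=G_0(x,x)=1$. Generalized trigonometric functions ($\alpha>0$): $C_{W,V}(\alpha,x)=\sum_{n\ge0}(-1)^n\alpha^{2n}F_{2n}(x,x)$, $S_{W,V}(\alpha,x)=\sum_{n\ge0}(-1)^n\alpha^{2n+1}F_{2n+1}(x,x)$, $C_{V,W}(\alpha,x)=\sum_{n\ge0}(-1)^n\alpha^{2n}G_{2n}(x,x)$, $S_{V,W}(\alpha,x)=\sum_{n\ge0}(-1)^n\alpha^{2n+1}G_{2n+1}(x,x)$ (uniformly and absolutely convergent series). *)

(* Defs.v *)
From HB Require Import structures.
From mathcomp Require Import all_boot all_order all_algebra.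
From mathcomp Require Import all_classical all_reals all_analysis.
Set Implicit Arguments.
Unset Strict Implicit.
Unset Printing Implicit Defensive.
Import Order.TTheory GRing.Theory Num.Theory.
Import numFieldTopology.Exports numFieldNormedType.Exports.
Local Open Scope classical_set_scope.
Local Open Scope ring_scope.

Definition cadlag (R : realType) (f : R -> R) : Prop :=
  forall x, f y @[y --> x^'+] --> f x /\ cvg (f y @[y --> x^'-]).

Definition caglad (R : realType) (f : R -> R) : Prop :=
  forall x, f y @[y --> x^'-] --> f x /\ cvg (f y @[y --> x^'+]).

Record integrators (R : realType) := Integrators {
  Wf : R -> R;
  Vf : R -> R;
  Wf_increasing : {homo Wf : x y / x < y};
  Vf_increasing : {homo Vf : x y / x < y};
  Wf_cadlag : cadlag Wf;
  Vf_caglad : caglad Vf;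
  Wf_periodic : forall x, Wf (x + 1) - Wf x = Wf 1 - Wf 0;
  Vf_periodic : forall x, Vf (x + 1) - Vf x = Vf 1 - Vf 0;
  Wf_continuous0 : {for 0, continuous Wf};
  Vf_continuous0 : {for 0, continuous Vf};
  Wf0 : Wf 0 = 0;
  Vf0 : Vf 0 = 0
}.

Section Measures.
Context (R : realType) (P : integrators R).
Notation borelR := (measurableTypeR R).

Lemma Wf_nondecreasing : nondecreasing (Wf P).
Proof. exact/ltW_homo/Wf_increasing. Qed.

Lemma Wf_right_continuous : right_continuous (Wf P).
Proof. by move=> x; have [] := Wf_cadlag P x. Qed.

HB.instance Definition _ := @isCumulative.Build R _ R (Wf P)
  Wf_nondecreasing Wf_right_continuous.

Definition dW : set borelR -> \bar R := lebesgue_stieltjes_measure (Wf P).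

HB.instance Definition _ := Measure.on dW.

Lemma dW_sigma_finite : sigma_finite setT dW.
Proof. exact: sigma_finiteT. Qed.

HB.instance Definition _ :=
  @Measure_isSigmaFinite.Build _ _ _ dW dW_sigma_finite.

(* Stieltjes measures are built from right-continuous functions, whereas V is
   left-continuous: dV is obtained by reflection from x |-> - V (- x), so that
   dV [a, b) is the mass V b - V a of (- b, - a]. *)
Definition reflectV : R -> R := fun x => - Vf P (- x).

Lemma reflectV_nondecreasing : nondecreasing reflectV.
Proof.
apply: ltW_homo => x y xy; rewrite /reflectV ltrN2.
by apply: Vf_increasing; rewrite ltrN2.
Qed.

Lemma reflectV_right_continuous : right_continuous reflectV.
Proof.
move=> x; apply: cvgN.
have [H _] := Vf_caglad P (- x).
by move: H => /cvg_at_leftNP; rewrite opprK.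
Qed.

HB.instance Definition _ := @isCumulative.Build R _ R reflectV
  reflectV_nondecreasing reflectV_right_continuous.

Definition dV : set borelR -> \bar R :=
  pushforward (lebesgue_stieltjes_measure reflectV)
    (-%R : borelR -> borelR).

Lemma measurable_opp : measurable_fun setT (-%R : borelR -> borelR).
Proof. by []. Qed.

Lemma dV0 : dV set0 = 0%E.
Proof. by rewrite /dV /pushforward preimage_set0 measure0. Qed.

Lemma dV_ge0 A : (0 <= dV A)%E.
Proof. exact: measure_ge0. Qed.

Lemma dV_semi_sigma_additive : semi_sigma_additive dV.
Proof.
have @opp_mfun : {mfun borelR >-> borelR}.
  by exists (-%R : borelR -> borelR); do 2!constructor; exact: measurable_opp.
exact: (@measure_semi_sigma_additive _ _ _
  (pushforward (lebesgue_stieltjes_measure reflectV) opp_mfun)).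
Qed.

HB.instance Definition _ := isMeasure.Build _ _ _ dV
  dV0 dV_ge0 dV_semi_sigma_additive.

Lemma stieltjes_itv_oc (f : cumulative R R) (a b : R) : a <= b ->
  lebesgue_stieltjes_measure f `]a, b]%classic = (f b - f a)%:E.
Proof.
move=> ab; rewrite /lebesgue_stieltjes_measure /measure_extension/=.
rewrite measurable_mu_extE/=; last exact: is_ocitv.
by rewrite wlength_itv_bnd.
Qed.

Lemma dW_itv_oc (a b : R) : a <= b ->
  dW `]a, b]%classic = (Wf P b - Wf P a)%:E.
Proof. exact: stieltjes_itv_oc. Qed.

Lemma dV_itv_co (a b : R) : a <= b ->
  dV `[a, b[%classic = (Vf P b - Vf P a)%:E.
Proof.
move=> ab; rewrite /dV /pushforward opp_preimage_itvbndbnd/=.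
by rewrite stieltjes_itv_oc ?lerN2//= /reflectV/= !opprK addrC.
Qed.

Lemma dV_sigma_finite : sigma_finite setT dV.
Proof.
exists (fun n => `[- n%:R, n%:R[%classic).
  apply/esym; rewrite -subTset => x _ /=.
  exists (Num.bound x) => //=; rewrite in_itv/=.
  by rewrite unstable.ltr_bound andbT lerNl ltW// unstable.ltrNbound.
move=> n; split; first exact: measurable_itv.
by rewrite dV_itv_co ?ltry// (@le_trans _ _ 0)// oppr_le0.
Qed.

HB.instance Definition _ :=
  @Measure_isSigmaFinite.Build _ _ _ dV dV_sigma_finite.

(* The torus is [0, 1): functions on it are functions on R taken modulo
   equality almost everywhere for dV restricted to [0, 1). *)
Definition dVT : set borelR -> \bar R :=
  mrestr dV (measurable_itv `[0, 1[ : measurable (`[0, 1[%classic : set borelR)).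

HB.instance Definition _ := Measure.on dVT.

End Measures.

Section Laplacian.
Context (R : realType) (P : integrators R).

Definition L2V : {pred (R -> R)} := Lfun (dVT P) 2%:E.

Definition L2V0 (g : R -> R) : Prop := g \in L2V /\ \int[dVT P]_x g x = 0.

Definition potential (g : R -> R) (x : R) : R :=
  \int[dW P]_(y in `]0, x]) \int[dV P]_(s in `[0, y[) g s.

(* The graph of the Laplacian: f belongs to its domain and is mapped to g. *)
Definition laplacian (f g : R -> R) : Prop :=
  [/\ f \in L2V, L2V0 g & exists a b : R,
    {ae dVT P, forall x, f x = a + b * Wf P x + potential g x} /\
    b * Wf P 1 + potential g 1 = 0].

Definition laplacian_domain (f : R -> R) : Prop := exists g, laplacian f g.

Definition eigenvector (lambda : R) (f : R -> R) : Prop :=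
  [/\ laplacian_domain f, ~ {ae dVT P, forall x, f x = 0} &
    exists2 g, laplacian f g & {ae dVT P, forall x, - g x = lambda * f x}].

End Laplacian.

Section GeneralizedTrigonometry.
Context (R : realType) (P : integrators R).

(* Only the values of Fpoly 0 and Gpoly 0 on the diagonal are meaningful, and
   the recursion does not use them. *)
Fixpoint Fpoly (n : nat) (x s : R) : R :=
  match n with
  | 0 => 1
  | 1 => Wf P s
  | (_.+1 as m).+1 =>
      if odd n
      then \int[dW P]_(xi in `]0, s]) (Fpoly m x x - Fpoly m x xi)
      else \int[dV P]_(xi in `[0, s[) (Fpoly m x x - Fpoly m x xi)
  end.

Fixpoint Gpoly (n : nat) (x s : R) : R :=
  match n with
  | 0 => 1
  | 1 => Vf P s
  | (_.+1 as m).+1 =>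
      if odd n
      then \int[dV P]_(xi in `[0, s[) (Gpoly m x x - Gpoly m x xi)
      else \int[dW P]_(xi in `]0, s]) (Gpoly m x x - Gpoly m x xi)
  end.

Definition C_WV (alpha x : R) : R :=
  limn (series (fun n => (-1) ^+ n * alpha ^+ (2 * n) * Fpoly (2 * n) x x)).

Definition S_WV (alpha x : R) : R :=
  limn (series (fun n => (-1) ^+ n * alpha ^+ (2 * n).+1 * Fpoly (2 * n).+1 x x)).

Definition C_VW (alpha x : R) : R :=
  limn (series (fun n => (-1) ^+ n * alpha ^+ (2 * n) * Gpoly (2 * n) x x)).

Definition S_VW (alpha x : R) : R :=
  limn (series (fun n => (-1) ^+ n * alpha ^+ (2 * n).+1 * Gpoly (2 * n).+1 x x)).

End GeneralizedTrigonometry.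

(* Main.v *)
(* Let A f(x) be the integral of f dV dW over 0 <= s < y <= x. An eigenvector
   agrees V-a.e. with the function u = a + b W - lambda A u; iterating this
   identity gives
     u = sum_(n < N) (- lambda)^n (a A^n 1 + b A^n W) + (- lambda)^N A^N u.
   Here A^n 1 <= (W(1) V(1))^n / n!, because the n variables integrated against
   dV are strictly ordered, so the remainder vanishes and u is a combination of
   the two series. Since A^n 1 and A^n W are the iterated integrals F_2n(x, x)
   and F_(2n+1)(x, x) taken in the opposite order (Fubini), these series are C_WV
   and S_WV / sqrt lambda. Then u(1) = a and the vanishing of the integral of
   u dV, expanded in the same way, are the two equations of the system. *)
Require Import Defs.
From HB Require Import structures.
From mathcomp Require Import all_boot all_order all_algebra.
From mathcomp Require Import all_classical all_reals all_analysis.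
From mathcomp Require Import measurable_realfun ring.
Import Order.TTheory GRing.Theory Num.Theory.
Import numFieldTopology.Exports numFieldNormedType.Exports.
Local Open Scope classical_set_scope.
Local Open Scope ring_scope.

Set Implicit Arguments.
Unset Strict Implicit.

(** * Bounded measurable functions on the line *)

Section BoundedMeasurable.
Context (R : realType).
Notation T := (measurableTypeR R).
Implicit Types (phi psi : R -> R).

(** For a finite measure this class consists of integrable functions and is stable under products
    and primitives, so integrability side conditions reduce to closure properties. *)
Definition bmeas phi :=
  measurable_fun (setT : set T) phi /\ exists M, forall x, `|phi x| <= M.

Lemma bmeas_cst c : bmeas (fun=> c).
Proof. by split; [exact: measurable_cst|exists `|c|]. Qed.

Lemma bmeasD phi psi : bmeas phi -> bmeas psi ->
  bmeas (fun x => phi x + psi x).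
Proof.
move=> [mp [M pM]] [mq [N qN]]; split; first exact: measurable_funD.
by exists (M + N) => x; rewrite (le_trans (ler_normD _ _))// lerD.
Qed.

Lemma bmeasM phi psi : bmeas phi -> bmeas psi ->
  bmeas (fun x => phi x * psi x).
Proof.
move=> [mp [M pM]] [mq [N qN]]; split; first exact: measurable_funM.
by exists (M * N) => x; rewrite normrM ler_pM.
Qed.

Lemma bmeasB phi psi : bmeas phi -> bmeas psi ->
  bmeas (fun x => phi x - psi x).
Proof.
move=> bp bq; have := bmeasD bp (bmeasM (bmeas_cst (-1)) bq).
by congr bmeas; apply/funext => x; rewrite mulN1r.
Qed.

Lemma bmeas_norm phi : bmeas phi -> bmeas (fun x => `|phi x|).
Proof.
move=> [mp [M pM]]; split; last by exists M => x; rewrite normr_id.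
exact: measurableT_comp.
Qed.

Lemma bmeas_integrable (mu : {finite_measure set T -> \bar R}) (D : set T) phi :
  measurable D -> bmeas phi -> mu.-integrable D (EFin \o phi).
Proof.
move=> mD [mp [M pM]]; apply: measurable_bounded_integrable => //.
- by rewrite ltey_eq fin_num_measure.
- exact: measurable_funTS.
- exists M; split; first exact: num_real.
  by move=> x Mx y _; rewrite /= (le_trans (pM y))// ltW.
Qed.

Lemma Rintegral_mass_le (mu : {finite_measure set T -> \bar R}) (D : set T)
    phi M : measurable D -> bmeas phi -> (forall x, D x -> phi x <= M) ->
  0 <= M -> \int[mu]_(x in D) phi x <= M * fine (mu setT).
Proof.
move=> mD bp pM M0; apply: (@le_trans _ _ (\int[mu]_(_ in D) M)).
  by apply: le_Rintegral => //; apply: bmeas_integrable => //; exact: bmeas_cst.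
rewrite Rintegral_cst// ler_wpM2l// fine_le ?fin_num_measure//.
by apply: le_measure; rewrite ?inE.
Qed.

End BoundedMeasurable.

(** * Primitives as integrals over left rays *)

Section Rays.
Context (R : realType).
Notation T := (measurableTypeR R).
Implicit Types (phi psi : R -> R) (w : bool) (x y s : R).

(** The boolean encodes the kind of integrator: [true] goes with dW and closed rays, [false] with dV
    and open ones. Unbounded rays give primitives on all of R; the measures used later live on the
    unit interval. *)
Definition ray w x : set T :=
  if w then `]-oo, x]%classic else `]-oo, x[%classic.

Lemma measurable_ray w x : measurable (ray w x).
Proof. by case: w; exact: measurable_itv. Qed.

Lemma rayE w x y : ray w x y = (if w then y <= x else y < x).
Proof. by case: w; rewrite /ray/= in_itv. Qed.

Lemma subset_ray w x y : x <= y -> ray w x `<=` ray w y.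
Proof.
move=> xy z; rewrite !rayE; case: w => [zx|zx]; first exact: le_trans xy.
exact: lt_le_trans xy.
Qed.

Lemma measurable_ray_diff w x s : measurable (ray w x `\` ray w s).
Proof. by apply: measurableD; exact: measurable_ray. Qed.

Variable mu : {finite_measure set T -> \bar R}.
Variable w : bool.

Definition rint phi x := \int[mu]_(y in ray w x) phi y.

Lemma rint_ge0 phi x : (forall y, 0 <= phi y) -> 0 <= rint phi x.
Proof. by move=> p0; apply: Rintegral_ge0 => y _. Qed.

Lemma rint_nondecreasing phi : mu.-integrable setT (EFin \o phi) ->
  (forall y, 0 <= phi y) -> {homo rint phi : x y / x <= y}.
Proof.
move=> ip p0 x y xy; apply: fine_le.
- by apply: integrable_fin_num; [exact: measurable_ray|
    apply: integrableS ip => //; exact: measurable_ray].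
- by apply: integrable_fin_num; [exact: measurable_ray|
    apply: integrableS ip => //; exact: measurable_ray].
- apply: ge0_subset_integral => //; try exact: measurable_ray.
  + by apply: measurable_funTS; case/integrableP: ip.
  + by move=> z _; rewrite lee_fin.
  + exact: subset_ray.
Qed.

Lemma bmeas_rint_ge0 phi : mu.-integrable setT (EFin \o phi) ->
  (forall y, 0 <= phi y) -> bmeas (rint phi).
Proof.
move=> ip p0; split.
  by apply: nondecreasing_measurable => //; exact: rint_nondecreasing.
exists (\int[mu]_y phi y) => x; rewrite ger0_norm ?rint_ge0//.
apply: fine_le.
- by apply: integrable_fin_num; [exact: measurable_ray|
    apply: integrableS ip => //; exact: measurable_ray].
- exact: integrable_fin_num.
- apply: ge0_subset_integral => //; first exact: measurable_ray.
  + by case/integrableP: ip.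
  + by move=> z _; rewrite lee_fin.
Qed.

Lemma rintD phi psi x : mu.-integrable setT (EFin \o phi) ->
  mu.-integrable setT (EFin \o psi) ->
  rint (fun y => phi y + psi y) x = rint phi x + rint psi x.
Proof.
move=> ip iq; apply: RintegralD; first exact: measurable_ray.
- by apply: integrableS ip => //; exact: measurable_ray.
- by apply: integrableS iq => //; exact: measurable_ray.
Qed.

Lemma rintZ c phi x : mu.-integrable setT (EFin \o phi) ->
  rint (fun y => c * phi y) x = c * rint phi x.
Proof.
move=> ip; apply: RintegralZl; first exact: measurable_ray.
by apply: integrableS ip => //; exact: measurable_ray.
Qed.

(** The primitives of the positive and negative parts are monotone, hence measurable, and bounded by
    the total integrals. Only integrability is assumed, so this covers a function known merely to be
    in L2. *)
Lemma bmeas_rint phi : mu.-integrable setT (EFin \o phi) -> bmeas (rint phi).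
Proof.
move=> ip.
have i1 : mu.-integrable setT (EFin \o phi^\+).
  have := integrable_funepos measurableT ip; congr (_.-integrable _ _).
  by rewrite funerpos.
have i2 : mu.-integrable setT (EFin \o phi^\-).
  have := integrable_funeneg measurableT ip; congr (_.-integrable _ _).
  by rewrite funerneg.
have := bmeasB (bmeas_rint_ge0 i1 (@funrpos_ge0 _ _ _))
               (bmeas_rint_ge0 i2 (@funrneg_ge0 _ _ _)).
congr bmeas; apply/funext => x.
rewrite /rint -RintegralB.
- by apply: eq_Rintegral => y _; rewrite -[in RHS](funrposBneg phi).
- exact: measurable_ray.
- by apply: integrableS i1 => //; exact: measurable_ray.
- by apply: integrableS i2 => //; exact: measurable_ray.
Qed.

Lemma ler_rint phi psi x : bmeas phi -> bmeas psi ->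
  (forall y, phi y <= psi y) -> rint phi x <= rint psi x.
Proof.
move=> bp bq pq; apply: le_Rintegral; try exact: measurable_ray.
- by apply: bmeas_integrable => //; exact: measurable_ray.
- by apply: bmeas_integrable => //; exact: measurable_ray.
- by [].
Qed.

Lemma rint_mass_le phi x M : bmeas phi -> (forall y, ray w x y -> phi y <= M) ->
  0 <= M -> rint phi x <= M * fine (mu setT).
Proof. by move=> *; apply: Rintegral_mass_le => //; exact: measurable_ray. Qed.

Lemma rintB phi x s : bmeas phi -> s <= x ->
  rint phi x - rint phi s = \int[mu]_(y in ray w x `\` ray w s) phi y.
Proof.
move=> bp sx; apply/eqP; rewrite subr_eq addrC; apply/eqP.
rewrite /rint -[in LHS](setDUK (subset_ray (w:=w) sx)) Rintegral_setU//.
- exact: measurable_ray.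
- exact: measurable_ray_diff.
- by apply: bmeas_integrable => //; apply: measurableU;
    [exact: measurable_ray|exact: measurable_ray_diff].
- by apply/disj_setPS => z [? []].
Qed.

End Rays.

(** * Exchange of the order of integration *)

Section Adjoint.
Context (R : realType).
Notation T := (measurableTypeR R).
Implicit Types (phi psi : R -> R) (w : bool) (x y s : R).

Lemma bmeas_patch (D : set T) phi : measurable D -> bmeas phi ->
  bmeas (phi \_ D).
Proof.
move=> mD [mp [M pM]]; split.
  by apply/(measurable_restrictT _ mD)/measurable_funTS.
exists M => x; rewrite patchE; case: ifPn => // _.
by rewrite normr0 (le_trans _ (pM x)).
Qed.

Lemma mem_ray w x y : (y \in ray w x) = (if w then y <= x else y < x).
Proof. by apply/idP/idP; rewrite inE/= rayE. Qed.

Lemma mem_ray_diff w x s y : (y \in ray w x `\` ray w s) =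
  (if w then s < y <= x else s <= y < x).
Proof.
rewrite setDE in_setI in_setC !mem_ray andbC.
by case: w; rewrite -?ltNge -?leNgt.
Qed.

Lemma EFin_RintegralZ (mu : {finite_measure set T -> \bar R}) (D : set T) c
    phi : measurable D -> bmeas phi ->
  (c * \int[mu]_(x in D) phi x)%:E = (\int[mu]_x (c * (phi \_ D) x)%:E)%E.
Proof.
move=> mD bp; have bpD := bmeas_patch mD bp.
rewrite Rintegral_mkcond -RintegralZl//; last exact: bmeas_integrable.
rewrite fineK//; apply: integrable_fin_num => //.
exact: (bmeas_integrable mu measurableT (bmeasM (bmeas_cst c) bpD)).
Qed.

(** Tonelli on the pairs (y, s) with y in the ray of x and s in the ray of y. As the two rays are of
    opposite kinds, the section at s is exactly a difference of rays of kind [w]. It is empty unless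
    s < x, which leaves freedom in the choice of [D]. *)
Lemma rint_adjoint (m1 m2 : {finite_measure set T -> \bar R}) w x (D : set T)
    phi psi : bmeas phi -> bmeas psi -> (forall y, 0 <= phi y) ->
  (forall y, 0 <= psi y) -> measurable D -> (forall s, s < x -> D s) ->
  \int[m1]_(y in ray w x) (psi y * rint m2 (~~ w) phi y) =
  \int[m2]_(s in D) (phi s * \int[m1]_(y in ray w x `\` ray w s) psi y).
Proof.
move=> bp bq p0 q0 mD xD.
pose g (p : T * T) := (if w then p.1 <= x else p.1 < x) &&
  (if w then p.2 < p.1 else p.2 <= p.1).
pose f p : \bar R := (if g p then psi p.1 * phi p.2 else 0)%:E.
have mg : measurable_fun setT g.
  apply: measurable_and; case: w @g @f => *.
  - exact: measurable_fun_ler.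
  - exact: measurable_fun_ltr.
  - exact: measurable_fun_ltr.
  - exact: measurable_fun_ler.
have mf : measurable_fun setT f.
  apply/measurable_EFinP; apply: measurable_fun_ifT => //.
  by apply: measurable_funM; apply: measurableT_comp => //; [case: bq|case: bp].
have f0 p : (0 <= f p)%E.
  by rewrite lee_fin; case: ifP => // _; rewrite mulr_ge0.
transitivity (fine (\int[m1]_y \int[m2]_s f (y, s))%E).
  rewrite Rintegral_mkcond; congr fine; apply: eq_integral => y _.
  rewrite patchE mem_ray /f /g/=; case: ifPn => xy/=; last by rewrite integral0.
  rewrite /rint EFin_RintegralZ//; last exact: measurable_ray.
  apply: eq_integral => s _; rewrite patchE mem_ray.
  by case: w {g f mg mf f0 xy} => /=; case: ifP => // _; rewrite mulr0.
rewrite fubini_tonelli// Rintegral_mkcond; congr fine.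
apply: eq_integral => s _; rewrite patchE; case: ifPn => sD.
  rewrite EFin_RintegralZ//; last exact: measurable_ray_diff.
  apply: eq_integral => y _; rewrite patchE mem_ray_diff /f /g/= andbC.
  by case: w {g f mg mf f0} => /=; case: ifP => _; rewrite ?mulr0// mulrC.
rewrite integral0_eq// => y _; rewrite /f /g/=; case: ifP => // /andP[yx sy].
move: sD; rewrite notin_setE => -[]; apply: xD.
case: w {g f mg mf f0} yx sy => yx sy; first exact: lt_le_trans yx.
exact: le_lt_trans yx.
Qed.

End Adjoint.

(** * Convergence of the series and unrolling of the recursion *)

Section AlternatingSeries.
Context (R : realType).
Implicit Types (a b c lam K : R) (u p q : nat -> R).

(** Comparison with the exponential series at [lam * c]. *)
Lemma is_cvg_alternating_series lam c K p : 0 <= lam -> 0 <= c -> 0 <= K ->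
  (forall n, `|p n| <= K * exp_coeff c n) ->
  cvgn (series (fun n => (- lam) ^+ n * p n)).
Proof.
move=> lam0 c0 K0 pK; apply: normed_cvg.
apply: (@series_le_cvg _ _ (fun n => K * exp_coeff (lam * c) n)).
- by move=> n; exact: normr_ge0.
- by move=> n; rewrite mulr_ge0// exp_coeff_ge0// mulr_ge0.
- move=> n; rewrite /= normrM normrX normrN (ger0_norm lam0).
  rewrite /exp_coeff/= exprMn.
  rewrite (_ : K * _ = lam ^+ n * (K * exp_coeff c n)) ?ler_wpM2l ?exprn_ge0//.
  by rewrite /exp_coeff/=; ring.
- exact/is_cvg_seriesZ/is_cvg_series_exp_coeff.
Qed.

(* Unrolling the recursion expresses [u 0] as a partial sum plus the remainder
   [(- lam) ^+ n * u n], which tends to 0. *)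
Lemma alternating_recursion lam a b u p q :
  cvgn (series (fun n => (- lam) ^+ n * u n)) ->
  cvgn (series (fun n => (- lam) ^+ n * p n)) ->
  cvgn (series (fun n => (- lam) ^+ n * q n)) ->
  (forall n, u n = a * p n + b * q n - lam * u n.+1) ->
  u 0 = a * limn (series (fun n => (- lam) ^+ n * p n)) +
        b * limn (series (fun n => (- lam) ^+ n * q n)).
Proof.
move=> cu cp cq rec.
have unroll n : u 0 = a * series (fun n => (- lam) ^+ n * p n) n +
    b * series (fun n => (- lam) ^+ n * q n) n + (- lam) ^+ n * u n.
  elim: n => [|n IH]; first by rewrite /series/= !big_geq//; ring.
  by rewrite !seriesSr/= {}IH (rec n) exprS; ring.
have : (fun=> u 0) @ \oo --> a * limn (series (fun n => (- lam) ^+ n * p n)) +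
    b * limn (series (fun n => (- lam) ^+ n * q n)) + 0.
  under eq_fun => n do rewrite (unroll n).
  apply: cvgD; last exact: cvg_series_cvg_0.
  by apply: cvgD; apply: cvgM => //; exact: cvg_cst.
by rewrite addr0 => /cvg_lim <-//; rewrite lim_cst.
Qed.

End AlternatingSeries.

(** * Iterated integrals and their factorial bounds *)

Section Chains.
Context (R : realType).
Notation T := (measurableTypeR R).
Implicit Types (phi psi : R -> R) (w : bool) (x y s : R).

Lemma bmeas_rint_bmeas (mu : {finite_measure set T -> \bar R}) w phi :
  bmeas phi -> bmeas (rint mu w phi).
Proof. by move=> bp; apply: bmeas_rint; exact: bmeas_integrable. Qed.

Lemma rint_lin (mu : {finite_measure set T -> \bar R}) w a b phi psi x :
  bmeas phi -> bmeas psi ->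
  rint mu w (fun y => a * phi y + b * psi y) x =
  a * rint mu w phi x + b * rint mu w psi x.
Proof.
move=> bp bq; rewrite rintD ?rintZ//; apply: bmeas_integrable => //.
  exact: bmeasM (bmeas_cst _) bp.
exact: bmeasM (bmeas_cst _) bq.
Qed.

Lemma rint_lin3 (mu : {finite_measure set T -> \bar R}) w a b c phi psi chi x :
  bmeas phi -> bmeas psi -> bmeas chi ->
  rint mu w (fun y => a * phi y + b * psi y - c * chi y) x =
  a * rint mu w phi x + b * rint mu w psi x - c * rint mu w chi x.
Proof.
move=> bp bq br; rewrite -mulNr -rint_lin// -[X in X + _]mul1r -rint_lin//.
  by apply: eq_Rintegral => y _; rewrite mul1r mulNr.
by apply: bmeasD; exact: bmeasM (bmeas_cst _) _.
Qed.

Lemma ler_norm_rint (mu : {finite_measure set T -> \bar R}) w phi x :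
  bmeas phi -> `|rint mu w phi x| <= rint mu w (fun y => `|phi y|) x.
Proof.
move=> bp; apply: le_normr_Rintegral; first exact: measurable_ray.
by apply: bmeas_integrable => //; exact: measurable_ray.
Qed.

(** The product measure of the strictly ordered n-tuples below x. Strictness keeps atoms on the
    diagonals out, so the bound by mass^n / n! survives atoms. *)
Definition iter_rint (mu : {finite_measure set T -> \bar R}) n : R -> R :=
  iter n (rint mu false) (fun=> 1).

Section IterRint.
Variable mu : {finite_measure set T -> \bar R}.

Lemma iter_rint_ge0 n x : 0 <= iter_rint mu n x.
Proof. by elim: n x => [|n IH] x//=; exact: rint_ge0. Qed.

Lemma bmeas_iter_rint n : bmeas (iter_rint mu n).
Proof.
by elim: n => [|n IH]; [exact: bmeas_cst|exact: bmeas_rint_bmeas].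
Qed.

(* Integrating over [t < x] the splitting
   [mu `]-oo, x[ = mu `]-oo, t[ + mu `[t, x[ ] and exchanging the order of
   integration in the second part. *)
Lemma iter_rintS_le n x :
  n.+1%:R * iter_rint mu n.+1 x <= iter_rint mu 1 x * iter_rint mu n x.
Proof.
elim: n x => [|n IH] x; first by rewrite mul1r mulr1.
set E := iter_rint mu; have bE k : bmeas (E k) := bmeas_iter_rint k.
have mr := measurable_ray false x.
have -> : E 1%N x * E n.+1 x =
    rint mu false (fun t => E 1%N t * E n t) x +
    rint mu false (fun t => E n t * (E 1%N x - E 1%N t)) x.
  rewrite -rintD; last 2 first.
  - by apply: bmeas_integrable => //; exact: bmeasM.
  - apply: bmeas_integrable => //; apply: bmeasM => //.
    exact: bmeasB (bmeas_cst _) _.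
  rewrite -[E n.+1 x]/(rint mu false (E n) x).
  rewrite -rintZ; last exact: bmeas_integrable.
  apply: eq_Rintegral => t _.
  by rewrite mulrBr addrC (mulrC (E 1%N t)) subrK mulrC.
rewrite -natr1 mulrDl mul1r -[E n.+2 x]/(rint mu false (E n.+1) x) lerD//.
  rewrite -rintZ; last exact: bmeas_integrable.
  apply: ler_rint; [|exact: bmeasM|exact: IH].
  exact: bmeasM (bmeas_cst _) _.
(* Since [[t, x[] contains t, the exchange yields an inner integral over a closed ray. Enlarging the
   open ray to it costs the possible atoms, whence an inequality only. *)
rewrite [leRHS](_ : _ = \int[mu]_(y in ray false x) (1 * rint mu true (E n) y)).
  apply: le_Rintegral => //.
  - by apply: bmeas_integrable => //; exact: (bE n.+1).
  - apply: bmeas_integrable => //.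
    exact: bmeasM (bmeas_cst _) (bmeas_rint_bmeas _ _ _).
  - move=> t _; rewrite mul1r; apply: fine_le.
    + by apply: integrable_fin_num; [exact: measurable_ray|
        apply: bmeas_integrable => //; exact: measurable_ray].
    + by apply: integrable_fin_num; [exact: measurable_ray|
        apply: bmeas_integrable => //; exact: measurable_ray].
    + apply: ge0_subset_integral; try exact: measurable_ray.
      * by apply/measurable_EFinP/measurable_funTS; case: (bE n).
      * by move=> z _; rewrite lee_fin iter_rint_ge0.
      * by move=> z; rewrite !rayE; exact: ltW.
rewrite (rint_adjoint mu mu false (D:=ray false x)) => //.
- apply: eq_Rintegral => t; rewrite inE rayE => tx.
  by rewrite /E/= rintB//; [exact: bmeas_cst|exact: ltW].
- exact: bmeas_cst.
- exact: iter_rint_ge0.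
Qed.

Lemma iter_rint_le n x : iter_rint mu n x <= exp_coeff (fine (mu setT)) n.
Proof.
elim: n => [|n IH]; first by rewrite /exp_coeff/= fact0 divr1.
have n0 : 0 < n.+1%:R :> R by rewrite ltr0n.
rewrite -(ler_pM2l n0) (le_trans (iter_rintS_le n x))//.
rewrite [leRHS](_ : _ = fine (mu setT) * exp_coeff (fine (mu setT)) n).
  apply: ler_pM => //; try exact: iter_rint_ge0.
  by rewrite -[leRHS]mul1r; apply: rint_mass_le => //; exact: bmeas_cst.
rewrite /exp_coeff/= exprS factS natrM invfM mulrCA mulVKf ?gt_eqF//.
by rewrite mulrA.
Qed.

End IterRint.

Variable m : bool -> {finite_measure set T -> \bar R}.

(* On [0, 1], [chain true n x] is F_n(x, x) and [chain false n x] is G_n(x, x):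
   here the variable next to [x] is integrated last, whereas the recursions
   defining F and G integrate it first. *)
Fixpoint chain w n : R -> R :=
  if n is k.+1 then rint (m w) w (chain (~~ w) k) else fun=> 1.

Lemma chain_ge0 w n x : 0 <= chain w n x.
Proof. by elim: n w x => [|n IH] w x //=; exact: rint_ge0. Qed.

Lemma bmeas_chain w n : bmeas (chain w n).
Proof.
by elim: n w => [|n IH] w; [exact: bmeas_cst|exact: bmeas_rint_bmeas].
Qed.

Lemma chain_nondecreasing w n : {homo chain w n : x y / x <= y}.
Proof.
case: n => [//|n]; apply: rint_nondecreasing; last exact: chain_ge0.
by apply: bmeas_integrable => //; exact: bmeas_chain.
Qed.

Let mass w : R := fine (m w setT).

Let mass_ge0 w : 0 <= mass w.
Proof. by rewrite fine_ge0. Qed.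

(** The additional integration is the innermost one and costs at most the mass of its measure; the
    sum of both masses avoids tracking which measure that is. *)
Lemma chainS_le w n x :
  chain w n.+1 x <= (mass true + mass false) * chain w n x.
Proof.
elim: n w x => [|n IH] w x.
  rewrite mulr1 (@le_trans _ _ (1 * mass w))//.
    by apply: rint_mass_le => //; exact: bmeas_cst.
  by rewrite mul1r; case: w; rewrite (lerDl, lerDr).
rewrite -[chain w n.+1 x]/(rint (m w) w (chain (~~ w) n) x) -rintZ; last first.
  by apply: bmeas_integrable => //; exact: bmeas_chain.
apply: (@ler_rint _ _ _ (chain (~~ w) n.+1)); [exact: bmeas_chain| |exact: IH].
exact: bmeasM (bmeas_cst _) (bmeas_chain _ _).
Qed.

(** Each integral against [m true] is at most its mass times the integrand at the endpoint, by
    monotonicity. What is left is n strictly ordered integrals against [m false], which supply the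
    factorial. *)
Lemma chain_double_le w n x :
  chain w n.*2 x <= exp_coeff (mass true * mass false) n.
Proof.
apply: (@le_trans _ _ (mass true ^+ n * iter_rint (m false) n x)); last first.
  rewrite /exp_coeff/= exprMn -mulrA ler_wpM2l ?exprn_ge0//.
  exact: iter_rint_le.
elim: n x => [|n IH] x; first by rewrite mul1r.
have rint_true_le w' k y :
    rint (m true) true (chain w' k) y <= mass true * chain w' k y.
  rewrite mulrC; apply: rint_mass_le; [exact: bmeas_chain| |exact: chain_ge0].
  by move=> z; rewrite rayE; exact: chain_nondecreasing.
have bc k := bmeas_chain w k.
have step : rint (m false) false (chain w n.*2) x <=
    mass true ^+ n * iter_rint (m false) n.+1 x.
  rewrite -[iter_rint _ _ x]/(rint (m false) false (iter_rint (m false) n) x).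
  rewrite -rintZ; last first.
    by apply: bmeas_integrable => //; exact: bmeas_iter_rint.
  apply: ler_rint => //; exact: bmeasM (bmeas_cst _) (bmeas_iter_rint _ _).
rewrite doubleS exprS -mulrA.
(* The integral against [m true] is the outermost one or the next one, according to [w]; it is
   bounded in place. *)
case: w bc step rint_true_le {IH} => bc step le_true.
  by rewrite (le_trans (le_true false n.*2.+1 x))// ler_wpM2l.
apply: le_trans (ler_wpM2l _ step) => //; rewrite -rintZ; last first.
  exact: bmeas_integrable.
apply: (@ler_rint _ _ _ (chain true n.*2.+1)); first exact: bmeas_chain.
  exact: bmeasM (bmeas_cst _) _.
exact: (le_true false n.*2).
Qed.

Lemma chain_le_exp_coeff w d n x : chain w (d + n.*2) x <=
  (mass true + mass false) ^+ d * exp_coeff (mass true * mass false) n.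
Proof.
elim: d x => [|d IH] x; first by rewrite mul1r chain_double_le.
rewrite (le_trans (chainS_le _ _ _))// exprS -mulrA ler_wpM2l ?addr_ge0//.
Qed.

Lemma is_cvg_chain_series lam w d x : 0 <= lam ->
  cvgn (series (fun n => (- lam) ^+ n * chain w (d + n.*2) x)).
Proof.
move=> lam0; apply: (@is_cvg_alternating_series _ lam (mass true * mass false)
  ((mass true + mass false) ^+ d)) => //.
- by rewrite mulr_ge0.
- by rewrite exprn_ge0// addr_ge0.
- by move=> n; rewrite ger0_norm ?chain_ge0//; exact: chain_le_exp_coeff.
Qed.

Lemma rint_le_chain M w k phi y : bmeas phi ->
  (forall z, `|phi z| <= M * chain (~~ w) k z) ->
  `|rint (m w) w phi y| <= M * chain w k.+1 y.
Proof.
move=> bp pM; rewrite (le_trans (ler_norm_rint _ _ _ bp))//.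
rewrite -[chain w k.+1 y]/(rint (m w) w (chain (~~ w) k) y) -rintZ; last first.
  by apply: bmeas_integrable => //; exact: bmeas_chain.
apply: ler_rint => //; first exact: bmeas_norm.
exact: bmeasM (bmeas_cst _) (bmeas_chain _ _).
Qed.

(** * Series expansion of a solution of the integral equation *)

Section Solution.
Variables (lam a b : R) (u : R -> R).
Hypotheses (lam0 : 0 <= lam) (bu : bmeas u).
Hypothesis solu : forall x, u x =
  a + b * chain true 1 x - lam * rint (m true) true (rint (m false) false u) x.

Let A phi := rint (m true) true (rint (m false) false phi).

Let bmeasA n : bmeas (iter n A u).
Proof. by elim: n => // n IH; do 2!apply: bmeas_rint_bmeas. Qed.

(** [A] is linear and lengthens a chain of kind [true] by two, so this is [solu] with [A] applied n
    times. *)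
Lemma iter_solution n x : iter n A u x =
  a * chain true n.*2 x + b * chain true n.*2.+1 x - lam * iter n.+1 A u x.
Proof.
elim: n x => [|n IH] x; first by rewrite mulr1; exact: solu.
have E y : rint (m false) false (iter n A u) y = a * chain false n.*2.+1 y +
    b * chain false n.*2.+2 y - lam * rint (m false) false (iter n.+1 A u) y.
  by rewrite [in LHS](funext IH) rint_lin3//; exact: bmeas_chain.
rewrite [in LHS]iterS /A (funext E) rint_lin3//; try exact: bmeas_chain.
by apply: bmeas_rint_bmeas; exact: (bmeasA n.+1).
Qed.

(** One further integration against [m false] prepares the expansion of the mean of u, the source of
    the second equation of the system. *)
Lemma rint_iter_solution n x : rint (m false) false (iter n A u) x =
  a * chain false n.*2.+1 x + b * chain false n.*2.+2 x -
  lam * rint (m false) false (iter n.+1 A u) x.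
Proof.
by rewrite [in LHS](funext (iter_solution n)) rint_lin3//; exact: bmeas_chain.
Qed.

Let iter_le M n x : (forall x, `|u x| <= M) ->
  `|iter n A u x| <= M * chain true n.*2 x.
Proof.
move=> uM; elim: n x => [|n IH] x; first by rewrite mulr1; exact: uM.
rewrite iterS doubleS; apply: rint_le_chain => [|y]; last exact: rint_le_chain.
exact: bmeas_rint_bmeas.
Qed.

(** Applied to the remainders themselves: their series converges, so its general term vanishes in
    the limit. *)
Let is_cvg_remainder M w d f x : 0 <= M ->
  (forall n, `|f n| <= M * chain w (d + n.*2) x) ->
  cvgn (series (fun n => (- lam) ^+ n * f n)).
Proof.
move=> M0 fM; apply: (@is_cvg_alternating_series _ lam (mass true * mass false)
  (M * (mass true + mass false) ^+ d)) => //.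
- by rewrite mulr_ge0.
- by rewrite mulr_ge0// exprn_ge0// addr_ge0.
- move=> n; rewrite (le_trans (fM n))// -mulrA ler_wpM2l//.
  exact: chain_le_exp_coeff.
Qed.

Lemma solution_series x :
  u x = a * limn (series (fun n => (- lam) ^+ n * chain true n.*2 x)) +
        b * limn (series (fun n => (- lam) ^+ n * chain true n.*2.+1 x)).
Proof.
have [_ [M uM]] := bu; have M0 : 0 <= M := le_trans (normr_ge0 _) (uM 0).
apply: (@alternating_recursion _ lam a b (fun n => iter n A u x)) => //.
- by apply: (is_cvg_remainder (d := 0) M0) => n; exact: iter_le.
- exact: (@is_cvg_chain_series lam true 0 x lam0).
- exact: (@is_cvg_chain_series lam true 1 x lam0).
- by move=> n; exact: iter_solution.
Qed.

Lemma rint_solution_series x : rint (m false) false u x =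
  a * limn (series (fun n => (- lam) ^+ n * chain false n.*2.+1 x)) +
  b * limn (series (fun n => (- lam) ^+ n * chain false n.*2.+2 x)).
Proof.
have [_ [M uM]] := bu; have M0 : 0 <= M := le_trans (normr_ge0 _) (uM 0).
apply: (@alternating_recursion _ lam a b
  (fun n => rint (m false) false (iter n A u) x)) => //.
- apply: (is_cvg_remainder (d := 1) M0) => n.
  by apply: rint_le_chain => // z; exact: iter_le.
- exact: (@is_cvg_chain_series lam false 1 x lam0).
- exact: (@is_cvg_chain_series lam false 2 x lam0).
- by move=> n; exact: rint_iter_solution.
Qed.

End Solution.

(* For k >= 1 and 0 <= s <= x <= 1, [tail true x k s] is F_k(x, x) - F_k(x, s)
   and [tail false x k s] is G_k(x, x) - G_k(x, s). *)
Fixpoint tail w x k s : R :=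
  if k is j.+1 then
    \int[m (w (+) odd j)]_(y in ray (w (+) odd j) x `\` ray (w (+) odd j) s)
      tail w x j y
  else 1.

Lemma tail_ge0 w x k s : 0 <= tail w x k s.
Proof. by elim: k s => [//|k IH] s; apply: Rintegral_ge0 => y _; exact: IH. Qed.

(** For s > x the difference of rays is empty; truncating s at x keeps the formula valid on the
    whole line, from which measurability in s follows. *)
Lemma tailE w x k s : bmeas (tail w x k) ->
  tail w x k.+1 s = rint (m (w (+) odd k)) (w (+) odd k) (tail w x k) x -
    rint (m (w (+) odd k)) (w (+) odd k) (tail w x k) (Num.min s x).
Proof.
move=> bt; rewrite rintB//; last by rewrite ge_min lexx orbT.
congr (Rintegral _ _ _); rewrite /=; have [//|xs] := leP s x.
rewrite setDv; apply/seteqP; split => // y [xy]; case.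
exact: subset_ray (ltW xs) _ xy.
Qed.

Lemma bmeas_tail w x k : bmeas (tail w x k).
Proof.
elim: k => [|k IH]; first exact: bmeas_cst.
rewrite (funext (fun s => tailE s IH)); apply: bmeasB; first exact: bmeas_cst.
have [mr [M rM]] := bmeas_rint_bmeas (m (w (+) odd k)) (w (+) odd k) IH.
split; last by exists M.
by apply: measurableT_comp mr _; exact: measurable_minr.
Qed.

(* The adjunction moves the integrations one by one from [chain] to [tail]. *)
Lemma chain_tail w j k x : chain w (j + k).+1 x =
  \int[m (w (+) odd k)]_(y in ray (w (+) odd k) x)
    (tail w x k y * chain (~~ (w (+) odd k)) j y).
Proof.
elim: k j => [|k IH] j.
  by rewrite addn0 addbF; apply: eq_Rintegral => y _; rewrite mul1r.
rewrite addnS -addSn IH /= addbN negbK.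
(* This [D] is the outer ray of the next stage. When it is closed, its endpoint s = x contributes
   nothing because the section there is empty. *)
rewrite (rint_adjoint _ _ _ (D := ray (~~ (w (+) odd k)) x)).
- by apply: eq_Rintegral => y _; rewrite mulrC.
- exact: bmeas_chain.
- exact: bmeas_tail.
- exact: chain_ge0.
- exact: tail_ge0.
- exact: measurable_ray.
- by move=> s sx; rewrite rayE; case: ifP => // _; exact: ltW.
Qed.

Lemma chain_rint_tail w k x : chain w k.+1 x =
  rint (m (w (+) odd k)) (w (+) odd k) (tail w x k) x.
Proof.
by rewrite -[k]add0n chain_tail; apply: eq_Rintegral => y _; rewrite mulr1.
Qed.

End Chains.

(** The complement of [D] is null for the restricted measure, and both measures agree on subsets of
    [D]. *)
Lemma Rintegral_mrestr (R : realType) (T := measurableTypeR R)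
    (mu : {measure set T -> \bar R}) (D E F : set T) (mD : measurable D)
    (f : R -> R) : measurable F -> F `&` D = E ->
  (mrestr mu mD).-integrable setT (EFin \o f) ->
  \int[mrestr mu mD]_(x in F) f x = \int[mu]_(x in E) f x.
Proof.
move=> mF <- fi; congr fine; rewrite (negligible_integral (N := ~` D)).
- rewrite setDE setCK; apply: eq_measure_integral => A mA AFD /=.
  by rewrite /mrestr setIidl// => x /AFD[].
- exact: measurableC.
- exact: mF.
- by apply: integrableS fi.
- by rewrite /= /mrestr setICl measure0.
Qed.

(** * Measures on the torus and generalized polynomials as chains *)

Section TorusMeasures.
Context (R : realType) (P : integrators R).
Notation T := (measurableTypeR R).
Implicit Types (f phi : R -> R) (w : bool) (s x y : R).

Let measurable_oc01 : measurable (`]0, 1] : set T).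
Proof. exact: measurable_itv. Qed.

(** The restriction is finite, and for 0 <= s <= 1 it cuts the closed ray of s down to []0, s]];
    likewise [dVT] cuts the open ray down to [[0, s[]. *)
Definition dWT : set T -> \bar R := mrestr (dW P) measurable_oc01.

HB.instance Definition _ := Measure.on dWT.

Lemma dWT_fin_num_fun : fin_num_fun dWT.
Proof.
move=> A mA; rewrite ge0_fin_numE//.
apply: (@le_lt_trans _ _ (dW P `]0, 1]%classic)); last first.
  by rewrite dW_itv_oc// ltry.
by apply: le_measure => /=; rewrite ?inE//; exact: measurableI.
Qed.

HB.instance Definition _ := Measure_isFinite.Build _ _ _ dWT dWT_fin_num_fun.

Lemma dVT_fin_num_fun : fin_num_fun (dVT P).
Proof.
move=> A mA; rewrite ge0_fin_numE//.
apply: (@le_lt_trans _ _ (dV P `[0, 1[%classic)); last first.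
  by rewrite dV_itv_co// ltry.
by apply: le_measure => /=; rewrite ?inE//; apply: measurableI.
Qed.

HB.instance Definition _ :=
  Measure_isFinite.Build _ _ _ (dVT P) dVT_fin_num_fun.

Definition torus_measure w : {finite_measure set T -> \bar R} :=
  if w then (dWT : {finite_measure set T -> \bar R})
  else (dVT P : {finite_measure set T -> \bar R}).

Local Notation m := torus_measure.

Lemma rint_dW f s : dWT.-integrable setT (EFin \o f) -> 0 <= s <= 1 ->
  rint (m true) true f s = \int[dW P]_(y in `]0, s]) f y.
Proof.
move=> fi /andP[s0 s1]; rewrite /rint/=; apply: Rintegral_mrestr => //.
apply/seteqP; split => y /=; rewrite !in_itv/=.
  by move=> [ys /andP[-> _]].
by move=> /andP[-> ys]; rewrite ys (le_trans ys).
Qed.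

Lemma rint_dV f s : (dVT P).-integrable setT (EFin \o f) -> 0 <= s <= 1 ->
  rint (m false) false f s = \int[dV P]_(y in `[0, s[) f y.
Proof.
move=> fi /andP[s0 s1]; rewrite /rint/=; apply: Rintegral_mrestr => //.
apply/seteqP; split => y /=; rewrite !in_itv/=.
  by move=> [ys /andP[-> _]].
by move=> /andP[-> ys]; rewrite ys (lt_le_trans ys).
Qed.

Lemma rint_dVT f : (dVT P).-integrable setT (EFin \o f) ->
  rint (m false) false f 1 = \int[dVT P]_x f x.
Proof.
move=> fi; rewrite /rint/=.
rewrite !(Rintegral_mrestr (E := `[0, 1[%classic))// ?setTI//.
apply/seteqP; split => y /=; rewrite !in_itv/=; first by case.
by move=> /andP[-> ->].
Qed.

Lemma rint_dW1 s : 0 <= s <= 1 -> rint (m true) true (fun=> 1) s = Wf P s.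
Proof.
move=> /[dup] s01 /andP[s0 _]; rewrite rint_dW//.
  by rewrite Rintegral_cst//= dW_itv_oc// mul1r Wf0 subr0.
exact/bmeas_integrable/bmeas_cst.
Qed.

Lemma rint_dV1 s : 0 <= s <= 1 -> rint (m false) false (fun=> 1) s = Vf P s.
Proof.
move=> /[dup] s01 /andP[s0 _]; rewrite rint_dV//.
  by rewrite Rintegral_cst//= dV_itv_co// mul1r Vf0 subr0.
exact/bmeas_integrable/bmeas_cst.
Qed.

Let tail_diff w x k s : s <= x ->
  rint (m (w (+) odd k)) (w (+) odd k) (tail m w x k) x -
  rint (m (w (+) odd k)) (w (+) odd k) (tail m w x k) s = tail m w x k.+1 s.
Proof. by move=> sx; rewrite rintB//; exact: bmeas_tail. Qed.

(** Has the shape of one step of the recursions for [Fpoly] and [Gpoly], so that both parities are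
    handled together. *)
Let torus_int w f s := if w then \int[dW P]_(y in `]0, s]) f y
  else \int[dV P]_(y in `[0, s[) f y.

Let torus_intE w f g s : bmeas f -> 0 <= s <= 1 ->
  (forall y, 0 <= y <= s -> g y = f y) -> torus_int w g s = rint (m w) w f s.
Proof.
move=> bf s01 gf; have fi := bmeas_integrable (m w) measurableT bf.
case: w fi => fi; rewrite (rint_dW, rint_dV)//; apply: eq_Rintegral => y.
  by rewrite inE/= in_itv/= => /andP[/ltW y0 ys]; rewrite gf// y0.
by rewrite inE/= in_itv/= => /andP[y0 /ltW ys]; rewrite gf// y0.
Qed.

(** With x fixed, induction on n: the integrand of the recursion is a difference of two primitives
    of a tail, that is, the next tail. *)
Lemma Fpoly_rint n x s : x <= 1 -> 0 <= s <= x ->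
  Fpoly P n.+1 x s = rint (m (~~ odd n)) (~~ odd n) (tail m true x n) s.
Proof.
move=> x1; elim: n s => [|n IH] s /andP[s0 sx]; have s1 := le_trans sx x1.
  by rewrite rint_dW1// s0.
have x0 := le_trans s0 sx.
transitivity (torus_int (~~ odd n.+1)
    (fun y => Fpoly P n.+1 x x - Fpoly P n.+1 x y) s) => [//|].
apply: torus_intE => [||y /andP[y0 ys]]; [exact: bmeas_tail|by rewrite s0|].
have yx := le_trans ys sx.
by rewrite !IH ?y0 ?x0 ?lexx// -addTb tail_diff.
Qed.

Lemma Gpoly_rint n x s : x <= 1 -> 0 <= s <= x ->
  Gpoly P n.+1 x s = rint (m (odd n)) (odd n) (tail m false x n) s.
Proof.
move=> x1; elim: n s => [|n IH] s /andP[s0 sx]; have s1 := le_trans sx x1.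
  by rewrite rint_dV1// s0.
have x0 := le_trans s0 sx.
transitivity (torus_int (odd n.+1)
    (fun y => Gpoly P n.+1 x x - Gpoly P n.+1 x y) s).
  by rewrite /torus_int -if_neg.
apply: torus_intE => [||y /andP[y0 ys]]; [exact: bmeas_tail|by rewrite s0|].
have yx := le_trans ys sx.
by rewrite !IH ?y0 ?x0 ?lexx// -[X in m X]addFb -[X in rint _ X]addFb tail_diff.
Qed.

Lemma Fpoly_chain n x : 0 <= x <= 1 -> Fpoly P n x x = chain m true n x.
Proof.
case: n => [//|n] /andP[x0 x1].
by rewrite Fpoly_rint ?x0 ?lexx// chain_rint_tail.
Qed.

Lemma Gpoly_chain n x : 0 <= x <= 1 -> Gpoly P n x x = chain m false n x.
Proof.
case: n => [//|n] /andP[x0 x1].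
by rewrite Gpoly_rint ?x0 ?lexx// chain_rint_tail.
Qed.

End TorusMeasures.

(** * Potentials and trigonometric functions in terms of chains *)

Section Eigenvectors.
Context (R : realType) (P : integrators R).
Notation T := (measurableTypeR R).
Local Notation m := (torus_measure P).
Implicit Types (f g : R -> R) (x r lam : R).

Lemma potential_rint g x : (dVT P).-integrable setT (EFin \o g) ->
  0 <= x <= 1 ->
  potential P g x = rint (m true) true (rint (m false) false g) x.
Proof.
move=> gi x01; have bg : bmeas (rint (m false) false g) by exact: bmeas_rint.
rewrite (rint_dW (bmeas_integrable _ measurableT bg) x01).
apply: eq_Rintegral => y; rewrite inE/= in_itv/= => /andP[/ltW y0 yx].
by rewrite rint_dV// y0 (le_trans yx)//; case/andP: x01.
Qed.

Lemma C_WV_chain r x : 0 <= x <= 1 ->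
  C_WV P r x = limn (series (fun n => (- r ^+ 2) ^+ n * chain m true n.*2 x)).
Proof.
move=> x01; congr (limn (series _)); apply/funext => n.
by rewrite Fpoly_chain// mul2n -muln2 mulnC exprM [in RHS]exprNn.
Qed.

Lemma S_WV_chain r x : 0 <= x <= 1 ->
  S_WV P r x =
  r * limn (series (fun n => (- r ^+ 2) ^+ n * chain m true n.*2.+1 x)).
Proof.
move=> x01; have cs := @is_cvg_chain_series _ m _ true 1 x (sqr_ge0 r).
rewrite -[RHS](lim_seriesZ r cs).
congr (limn (series _)); apply/funext => n.
rewrite [RHS](_ : _ = r * ((- r ^+ 2) ^+ n * chain m true n.*2.+1 x))//.
rewrite Fpoly_chain// mul2n (exprNn (r ^+ 2)) [in LHS]exprS -mul2n exprM.
by ring.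
Qed.

Lemma S_VW_chain r x : 0 <= x <= 1 ->
  S_VW P r x =
  r * limn (series (fun n => (- r ^+ 2) ^+ n * chain m false n.*2.+1 x)).
Proof.
move=> x01; have cs := @is_cvg_chain_series _ m _ false 1 x (sqr_ge0 r).
rewrite -[RHS](lim_seriesZ r cs).
congr (limn (series _)); apply/funext => n.
rewrite [RHS](_ : _ = r * ((- r ^+ 2) ^+ n * chain m false n.*2.+1 x))//.
rewrite Gpoly_chain// mul2n (exprNn (r ^+ 2)) [in LHS]exprS -mul2n exprM.
by ring.
Qed.

(** The constant term is split off and the index shifted, to match the series multiplying b in
    [rint_solution_series]. *)
Lemma C_VW_chain r x : 0 <= x <= 1 ->
  C_VW P r x = 1 -
  r ^+ 2 * limn (series (fun n => (- r ^+ 2) ^+ n * chain m false n.*2.+2 x)).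
Proof.
move=> x01.
have cs := @is_cvg_chain_series _ m _ false 2 x (sqr_ge0 r).
set p := fun n => _ * chain _ _ _ _ in cs *.
have E n :
    series (fun n => (-1) ^+ n * r ^+ (2 * n) * Gpoly P (2 * n) x x) n.+1 =
    1 - r ^+ 2 * series p n.
  elim: n => [|n IH].
    by rewrite seriesSr /series/= !big_geq// !mulr1 add0r mulr0 subr0.
  rewrite seriesSr IH [in RHS]seriesSr /p Gpoly_chain// (exprM r 2) -exprMn.
  by rewrite mulN1r mul2n doubleS (exprS (- r ^+ 2)); ring.
apply/cvg_lim => //; rewrite -cvg_shiftS /=; under eq_fun do rewrite E.
by apply: cvgB; [exact: cvg_cst|apply: cvgM => //; exact: cvg_cst].
Qed.

End Eigenvectors.

(** * The eigenvalue problem *)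

Lemma ae_dVT_itv (R : realType) (P : integrators R) :
  {ae dVT P, forall x, 0 <= x < 1}.
Proof.
exists (~` `[0, 1[%classic); split; first exact: measurableC.
  by rewrite /dVT /mrestr/= setICl measure0.
by move=> x /=; rewrite in_itv.
Qed.

Theorem proposition2p3p1 (R : realType) (P : integrators R)
    (lambda : R) (nu : R -> R) :
  0 < lambda -> eigenvector P lambda nu ->
  let r := Num.sqrt lambda in
  exists a b : R,
    [/\ (a, b) <> (0, 0),
        {ae dVT P, forall x, nu x = a * C_WV P r x + b / r * S_WV P r x},
        a * (C_WV P r 1 - 1) + b / r * S_WV P r 1 = 0 &
        a / r * S_VW P r 1 - b / lambda * (C_VW P r 1 - 1) = 0].
Proof.
move=> lam0 [_ nuN0 [g [_ [gL2 gint] [a [b [nuE bc]]]] gE]] r.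
have r0 : 0 < r by rewrite sqrtr_gt0.
have r2 : r ^+ 2 = lambda by rewrite sqr_sqrtr// ltW.
have rN0 : r != 0 by rewrite gt_eqF.
set m := torus_measure P.
have aeF := ae_filter_ringOfSetsType (dVT P).
have gi : (dVT P).-integrable setT (EFin \o g).
  by apply/Lfun1_integrable; apply: Lfun_subset12 gL2; exact: fin_num_measure.
have bS : bmeas (rint (m false) false g) by exact: bmeas_rint.
(* An everywhere defined, bounded measurable representative of [nu]. *)
pose u x := a + b * chain m true 1 x +
  rint (m true) true (rint (m false) false g) x.
have bu : bmeas u.
  apply: bmeasD; last exact: bmeas_rint_bmeas.
  apply: bmeasD; first exact: bmeas_cst.
  by apply: bmeasM; [exact: bmeas_cst|exact: bmeas_chain].
have uE x : 0 <= x <= 1 -> u x = a + b * Wf P x + potential P g x.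
  by move=> x01; rewrite potential_rint// -rint_dW1.
have nu_u : {ae dVT P, forall x, nu x = u x}.
  apply: (filterS2 aeF _ nuE (ae_dVT_itv P)) => x -> /andP[x0 /ltW x1].
  by rewrite uE// x0.
(* A primitive depends only on the V-a.e. class of its integrand. This turns the a.e. eigenvalue
   equation into an integral equation for [u] at every point. *)
have gu x : rint (m false) false g x = - lambda * rint (m false) false u x.
  rewrite -rintZ; last exact: bmeas_integrable.
  congr fine; apply: ae_eq_integral.
  - exact: measurable_ray.
  - by apply: measurable_funTS; case/integrableP: gi.
  - apply/measurable_EFinP/measurable_funTS.
    by have [] := bmeasM (bmeas_cst (- lambda)) bu.
  - apply: (filterS2 aeF _ gE nu_u) => y gy <- _; congr EFin.
    by rewrite mulNr -gy opprK.
have solu x : u x = a + b * chain m true 1 x -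
    lambda * rint (m true) true (rint (m false) false u) x.
  rewrite {1}/u (funext gu) rintZ ?mulNr//.
  exact/bmeas_integrable/bmeas_rint_bmeas.
have ser x : 0 <= x <= 1 -> u x = a * C_WV P r x + b / r * S_WV P r x.
  move=> x01; rewrite C_WV_chain// S_WV_chain// r2 mulrA divfK//.
  exact: (solution_series (ltW lam0) bu solu).
have one01 : 0 <= (1 : R) <= 1 by rewrite ler01 lexx.
exists a, b; split.
- move=> [a0 b0]; apply: nuN0.
  apply: (filterS2 aeF _ nu_u (ae_dVT_itv P)) => x -> /andP[x0 /ltW x1].
  by rewrite ser ?x0// a0 b0 !mul0r addr0.
- apply: (filterS2 aeF _ nu_u (ae_dVT_itv P)) => x -> /andP[x0 /ltW x1].
  by rewrite ser ?x0.
(* The boundary condition [bc] says that u(1) = a. *)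
- by rewrite mulrBr mulr1 addrAC -ser// uE// -(addrA a) bc addr0 subrr.
(* At x = 1 the identity [gu] compares means; that of [g] is zero and lambda is nonzero, so [u] has
   mean zero. Its series expansion is the second equation. *)
- have u1 : rint (m false) false u 1 = 0.
    have := gu 1; rewrite rint_dVT// gint => /esym/eqP.
    by rewrite mulf_eq0 oppr_eq0 gt_eqF//= => /eqP.
  rewrite -[RHS]u1 (rint_solution_series (ltW lam0) bu solu).
  rewrite S_VW_chain// C_VW_chain// r2.
  by field; rewrite rN0 gt_eqF.
Qed.
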